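(* There exist absolute constants $c_1,c_2>0$ such that the following holds. Let $\mathbb F_q$ be a finite field of odd order $q$. Let $Q\in\mathbb F_q[X,Y]$ be a binary quadratic form with non-zero discriminant and let $L\in\mathbb F_q[X,Y]$ be a (non-zero) binary linear form not dividing $Q$ in $\mathbb F_q[X,Y]$. Then $$c_1\log q\le N_q(L,Q)\le c_2\sqrt q.$$
   Context: A binary linear form is $L(X,Y)=a_1X+a_2Y$ with $a_1,a_2\in\mathbb F_q$, and a binary quadratic form is $Q(X,Y)=b_1X^2+b_2XY+b_3Y^2$ with $b_1,b_2,b_3\in\mathbb F_q$; its discriminant is $\mathrm{disc}(Q)=b_2^2-4b_1b_3$. The quantity $N_q(L,Q)$ is the smallest integer $k$ such that for every subset $A\subset\mathbb F_q$ with $|A|\ge k$ there exists $(x,y)\in\mathbb F_q^2$ with $L(x,y)\in A$ and $Q(x,y)\in A$. *)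

(* Defs.v *)
From HB Require Import structures.
From mathcomp Require Import all_boot all_order all_algebra.
From mathcomp Require Import mpoly.

Set Implicit Arguments.
Unset Strict Implicit.
Unset Printing Implicit Defensive.

Import GRing.Theory.
Local Open Scope ring_scope.

(* F[X, Y] is {mpoly F[2]}, with X = 'X_0 and Y = 'X_1. *)

Definition linear_form (F : finFieldType) (a1 a2 : F) : {mpoly F[2]} :=
  a1 *: 'X_0 + a2 *: 'X_1.

Definition quadratic_form (F : finFieldType) (b1 b2 b3 : F) : {mpoly F[2]} :=
  b1 *: 'X_0 ^+ 2 + b2 *: ('X_0 * 'X_1) + b3 *: 'X_1 ^+ 2.

Definition disc (F : finFieldType) (b1 b2 b3 : F) : F :=
  b2 ^+ 2 - 4%:R * b1 * b3.

Definition eval2 (F : finFieldType) (P : {mpoly F[2]}) (x y : F) : F :=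
  P.@[tnth [tuple x; y]].

Definition represented_in_large_sets (F : finFieldType)
    (L Q : {mpoly F[2]}) (k : nat) : bool :=
  [forall A : {set F}, (k <= #|A|)%N ==>
     [exists x : F, exists y : F, (eval2 L x y \in A) && (eval2 Q x y \in A)]].

Lemma represented_in_large_sets_ex (F : finFieldType) (L Q : {mpoly F[2]}) :
  exists k : nat, represented_in_large_sets L Q k.
Proof.
exists #|F|.+1; apply/forallP => A; apply/implyP => /leq_trans.
by move=> /(_ _ (max_card _)); rewrite ltnn.
Qed.

(* Minimising over nat rather than over the integers changes nothing: k <= 0
   always fails, because of the empty set. *)
Definition Nq (F : finFieldType) (L Q : {mpoly F[2]}) : nat :=
  ex_minn (represented_in_large_sets_ex L Q).

(* Main.v *)
(**
The quadratic form 4 g Q + disc(Q) L^2, with g = Q(a2, -a1), is the square of a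
linear form M that is independent of L.  Hence L and Q take simultaneous values
in A if and only if 4 g w + disc(Q) u^2 is a square for some u, w in A.

Upper bound: if it is a nonsquare for all u, w in A, a second moment estimate
for the sum over u of the quadratic character gives |A|^2 <= 2 q.

Lower bound: take A = {s h^i : i < k} with h a square.  For u = s h^i and
w = s h^j the value is, up to a square, disc(Q) (t + h^(2i - j + k)), where t
and s determine each other; only 3k exponents occur.  So it is enough that some
nonzero t makes t + h^l take a prescribed quadratic character for all l < 3k.
This follows from bounds for the sums of the quadratic character over products
of distinct linear polynomials, which are proved by Stepanov's method; as they
have to hold up to degree of order log q only, a crude form is enough.
*)
Require Import Defs.
From mathcomp Require Import all_boot all_order all_algebra.
From mathcomp Require Import finfield cyclic.
From mathcomp Require Import mpoly reals.
From mathcomp Require exp.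
From mathcomp Require Import ring zify.

Set Implicit Arguments.
Unset Strict Implicit.
Unset Printing Implicit Defensive.

Import Order.TTheory GRing.Theory Num.Theory.
Local Open Scope ring_scope.

(** * Hasse derivatives and powers of linear polynomials *)

Lemma nderivnMXsubC (R : comNzRingType) (n : nat) (p : {poly R}) (c : R) :
  (p * ('X - c%:P))^`N(n.+1) = p^`N(n) + p^`N(n.+1) * ('X - c%:P).
Proof.
have := nderivnMXaddC n p 0; rewrite addr0 => h.
by rewrite !mulrBr nderivnB h !(mulrC _ c%:P) !mul_polyC nderivnZ addrA.
Qed.

Lemma dvdp_XsubC_exp_nderivn (F : fieldType) (c : F) (N k : nat) (p : {poly F}) :
  ('X - c%:P) ^+ N %| p -> ('X - c%:P) ^+ (N - k) %| p^`N(k).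
Proof.
move=> /dvdpP [q ->{p}].
elim: N k => [|N IH] [|k]; rewrite ?sub0n ?expr0 ?dvd1p ?subn0 ?nderivn0 ?dvdp_mull //.
rewrite exprSr mulrA nderivnMXsubC subSS dvdp_add //.
have [leNk|ltkN] := leqP N k.
  by rewrite (_ : (N - k)%N = 0%N) ?expr0 ?dvd1p //; apply/eqP.
by rewrite -(@ltn_predK 0%N (N - k)) ?subn_gt0 // exprSr dvdp_mul // -subnS.
Qed.

Lemma horner_nderivn_XsubC_exp (F : fieldType) (c : F) (k : nat) (p : {poly F}) :
  (p * ('X - c%:P) ^+ k)^`N(k).[c] = p.[c].
Proof.
elim: k => [|k IH]; first by rewrite expr0 mulr1 nderivn0.
by rewrite exprSr mulrA nderivnMXsubC !hornerE IH subrr mulr0 addr0.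
Qed.

(** Hasse derivatives carry no factor k!, so they detect the order of a zero in every
    characteristic, at any order. *)
Lemma dvdp_XsubC_expP (F : fieldType) (c : F) (n : nat) (p : {poly F}) :
  (forall k, (k < n)%N -> p^`N(k).[c] = 0) -> ('X - c%:P) ^+ n %| p.
Proof.
elim: n => [|n IH] dp; first by rewrite expr0 dvd1p.
have /dvdpP [q def_p] := IH (fun k ltkn => dp k (leqW ltkn)).
have := dp n (ltnSn n); rewrite def_p horner_nderivn_XsubC_exp => qc0.
by rewrite exprS dvdp_mul // dvdp_XsubCl; apply/rootP.
Qed.

Lemma dvdp_prod_XsubC_exp (F : fieldType) (s : seq F) (n : nat) (p : {poly F}) :
  uniq s -> {in s, forall x, ('X - x%:P) ^+ n %| p} ->
  (\prod_(x <- s) ('X - x%:P)) ^+ n %| p.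
Proof.
elim: s => [|x s IH] /=; first by rewrite big_nil expr1n dvd1p.
move=> /andP [xs us] dp; rewrite big_cons exprMn Gauss_dvdp.
  rewrite dp ?mem_head //= IH // => y ys.
  by rewrite dp // inE ys orbT.
apply/coprimep_expl/coprimep_expr.
by rewrite coprimep_sym coprimep_XsubC root_prod_XsubC.
Qed.


Lemma XsubC_exp_card (F : finFieldType) (c : F) :
  ('X - c%:P) ^+ #|F| = 'X^#|F| - c%:P.
Proof.
have [p p_pr pcharFp] := finPcharP F.
have qp : [pchar {poly F}]%R.-nat #|F|.
  rewrite (card_pprimeChar pcharFp) pnatX pnatE //.
  by rewrite (pchar_lalg {poly F}) pcharFp.
rewrite exprDn_pchar // -polyCN -rmorphXn /=; congr (_ + _%:P).
by rewrite expf_card.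
Qed.

Lemma dvdp_XsubC_expX (F : finFieldType) (x : F) (n j : nat) :
  (n <= #|F|)%N -> ('X - x%:P) ^+ n %| 'X^(#|F| * j) - (x ^+ j)%:P.
Proof.
move=> lenq; apply: (dvdp_trans (dvdp_exp2l _ lenq)).
rewrite XsubC_exp_card exprM rmorphXn /= subrXX; exact: dvdp_mulr.
Qed.

(** By Frobenius the [q]-th power of a polynomial f over [F] is f(X^q), so only the constant term
    survives modulo X^q. *)
Lemma prod_XsubC_exp_card (F : finFieldType) (s : seq F) :
  'X^#|F| %| (\prod_(x <- s) ('X - x%:P)) ^+ #|F| - (\prod_(x <- s) ('X - x%:P)).[0]%:P.
Proof.
elim: s => [|x s IH]; first by rewrite !big_nil expr1n hornerE subrr dvdp0.
rewrite !big_cons exprMn XsubC_exp_card hornerM !hornerE polyCM.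
set u := (\prod_(_ <- _) _) ^+ _ in IH *; set v := (_.[0])%:P in IH *.
have -> : ('X^#|F| - x%:P) * u - (- x)%:P * v = 'X^#|F| * u + (- x)%:P * (u - v).
  by rewrite polyCN; ring.
by apply: dvdp_add; [exact: dvdp_mulr | exact: dvdp_mull].
Qed.

(** For nonzero [r] and [t], a root [x] in [s] would have odd multiplicity on the left and even
    multiplicity on the right. *)
Lemma sqr_prod_XsubC_eq (F : fieldType) (s : seq F) (c : F) (r t : {poly F}) :
  uniq s -> s != [::] -> c != 0 ->
  r ^+ 2 * \prod_(x <- s) ('X - x%:P) = c *: t ^+ 2 -> r = 0 /\ t = 0.
Proof.
case: s => // x s us _ c0 eq_rt.
set f := \prod_(_ <- _) _ in eq_rt.
have f0 : f != 0 by rewrite monic_neq0 ?monic_prod_XsubC.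
have [r0|r0] := eqVneq r 0.
  split=> //; move/esym/eqP: eq_rt; rewrite r0 expr0n mul0r scaler_eq0 (negPf c0) /=.
  by rewrite expf_eq0 /= => /eqP.
have [t0|t0] := eqVneq t 0.
  move/eqP: eq_rt; rewrite t0 expr0n scaler0 mulf_eq0 expf_eq0 /= (negPf r0) /=.
  by rewrite (negPf f0).
have /(congr1 (mup x)) := eq_rt; rewrite -mul_polyC !mupM ?expf_neq0 ?polyC_eq0 //.
rewrite mu_prod_XsubC count_uniq_mem // mem_head.
by rewrite [mup x c%:P]mupNroot ?rootC //= => /(congr1 odd); rewrite !oddD /=; do 2!case: (odd _).
Qed.

(** * Stepanov's method *)

(** The lowest term is divisible by X^n, hence vanishes; then X^n cancels and the next term becomes
    the lowest. *)
Lemma sum_mulXn_eq0 (F : fieldType) (n J : nat) (B : nat -> {poly F}) :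
  (forall j, (j < J)%N -> 'X^n %| B j -> B j = 0) ->
  \sum_(j < J) B j * 'X^(n * j) = 0 -> forall j, (j < J)%N -> B j = 0.
Proof.
elim: J B => [|J IH] B B0 //.
rewrite big_ord_recl muln0 expr0 mulr1 /=.
under eq_bigr => i _ do rewrite /bump add1n mulnS exprD mulrCA.
rewrite -mulr_sumr => eqB.
have B00 : B 0%N = 0.
  apply: B0 => //; move/eqP: eqB; rewrite addr_eq0 => /eqP ->.
  by rewrite dvdpNr dvdp_mulr.
move: eqB; rewrite B00 add0r => /eqP; rewrite mulf_eq0 expf_eq0 polyX_eq0 andbF /=.
move=> /eqP eqB [|j] // ltjJ.
by apply: (IH (fun j => B j.+1)) => // i ltiJ; apply: B0.
Qed.

Lemma size_monic_exp (R : nzRingType) (p : {poly R}) (n : nat) :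
  p \is monic -> size (p ^+ n) = ((size p).-1 * n).+1.
Proof.
move=> p_mon; elim: n => [|n IH]; first by rewrite muln0 expr0 size_poly1.
rewrite exprS size_monicM ?monic_neq0 ?monic_exp // IH addnS /= mulnS.
by rewrite -addSn prednK // size_poly_gt0 monic_neq0.
Qed.

Section Stepanov.

Variables (F : finFieldType) (s : seq F).
Hypotheses (us : uniq s) (s0 : 0 \notin s) (s_neq0 : s != [::]).
Local Notation q := #|F|.
Let m := size s.
Let f := \prod_(x <- s) ('X - x%:P).
(* [lam] is half the order of vanishing imposed on the auxiliary polynomial. *)
Variables (N d lam : nat).
(** [le_d] keeps degrees below [q] in [stepanov_independent]; [lam_small] makes the unknowns
    outnumber the equations in [cond_solution]. *)
Hypotheses (qE : q = N.*2.+1) (le_d : (2 * d + m <= q)%N).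
Hypotheses (lam_gt0 : (0 < lam)%N) (lam_small : (2 * lam ^ 2 * m + lam ^ 2 < d)%N).
Let l := (2 * lam)%N.

Let f_monic : f \is monic. Proof. exact: monic_prod_XsubC. Qed.
Let f_neq0 : f != 0. Proof. exact: monic_neq0. Qed.
Let size_fX n : size (f ^+ n) = (m * n).+1.
Proof. by rewrite size_monic_exp // size_prod_XsubC. Qed.

(** Multiplying by (r - t f^N) f and reducing f^q to f(0) gives r^2 f = f(0) t^2 modulo X^q. Both
    sides have degree below [q], so they are equal and [sqr_prod_XsubC_eq] applies. *)
Lemma stepanov_independent (r t : {poly F}) :
  (size r <= d)%N -> (size t <= d)%N -> 'X^q %| r + t * f ^+ N -> r = 0 /\ t = 0.
Proof.
move=> sr st dv; apply: (@sqr_prod_XsubC_eq _ s f.[0]) => //.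
  by apply: contraNneq s0 => /rootP; rewrite root_prod_XsubC.
rewrite -/f.
have fq : f ^+ q = f * (f ^+ N * f ^+ N) by rewrite qE -addnn exprS exprD.
have dv1 : 'X^q %| r ^+ 2 * f - t ^+ 2 * f ^+ q.
  suff -> : r ^+ 2 * f - t ^+ 2 * f ^+ q
          = (r + t * f ^+ N) * ((r - t * f ^+ N) * f) by exact: dvdp_mulr.
  by rewrite fq; ring.
have dv2 : 'X^q %| r ^+ 2 * f - f.[0] *: t ^+ 2.
  suff -> : r ^+ 2 * f - f.[0] *: t ^+ 2
          = (r ^+ 2 * f - t ^+ 2 * f ^+ q) + t ^+ 2 * (f ^+ q - f.[0]%:P).
    by rewrite dvdp_addr // dvdp_mull // prod_XsubC_exp_card.
  by rewrite -mul_polyC; ring.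
apply/eqP; rewrite -subr_eq0; apply: contraTT dv2 => nz.
apply/negP => /(dvdp_leq nz); rewrite size_polyXn leqNgt ltnS => /negP; apply.
have sz2 (p : {poly F}) : (size p <= d)%N -> (size (p ^+ 2)%R <= 2 * d)%N.
  move=> sp; apply: leq_trans (size_polyMleq _ _) _.
  by apply: leq_trans (leq_pred _) _; rewrite mul2n -addnn leq_add.
apply: leq_trans (size_polyD _ _) _; rewrite size_polyN geq_max; apply/andP; split.
  apply: leq_trans (size_polyMleq _ _) _.
  by rewrite -[f]expr1 size_fX muln1 addnS /=; apply: leq_trans le_d; rewrite leq_add2r sz2.
by apply: leq_trans (size_scale_leq _ _) _; apply: leq_trans (sz2 _ st) _; lia.
Qed.

(* The quotient is exact ([D_eq]); writing it as a division makes linearity in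
   [p] evident. *)
Let D k n (p : {poly F}) := (p * f ^+ n)^`N(k) %/ f ^+ (n - k).

Let D_is_additive k n p p' : D k n (p - p') = D k n p - D k n p'.
Proof. by rewrite /D mulrBl nderivnB divpD divpN. Qed.

Let D_eq k n p : (p * f ^+ n)^`N(k) = D k n p * f ^+ (n - k).
Proof.
rewrite divpK //; apply: dvdp_prod_XsubC_exp => // x xs.
apply/dvdp_XsubC_exp_nderivn/dvdp_mull/dvdp_exp2r.
by rewrite dvdp_XsubCl root_prod_XsubC.
Qed.

(** Dividing out [f ^+ (n - k)] makes the bound independent of [n], which is what keeps the terms
    with [n = l + N] small. *)
Let size_D k n (p : {poly F}) : (k <= n)%N -> (size p <= d)%N -> (size (D k n p) <= d + m * k)%N.
Proof.
move=> lekn sp; rewrite size_divp ?expf_neq0 // size_fX /=.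
apply: leq_trans (leq_sub2r _ (leq_trans (size_poly _ _) (leq_subr _ _))) _.
rewrite leq_subLR; apply: leq_trans (size_polyMleq _ _) _.
by rewrite size_fX addnS /= addnCA -mulnDr subnK // leq_add2r.
Qed.

(* [aux u] is Stepanov's auxiliary polynomial.  At a point [x] with
   [f.[x] ^+ N = a], the identity [x ^+ q = x] turns its [k]-th Hasse derivative
   into [f.[x] ^+ (l - k) * (cond a u k).[x]], whose second factor has small
   degree; so few linear equations on [u] force a zero of order [l] at all these
   points. *)
Let coefs : Type := ('M[F]_(lam.+1, d) * 'M[F]_(lam.+1, d))%type.
Let r_ (u : coefs) j := rVpoly (row (inord j) u.1).
Let t_ (u : coefs) j := rVpoly (row (inord j) u.2).
Let aux u := \sum_(j < lam.+1)
  (r_ u j * f ^+ l + t_ u j * f ^+ (l + N)) * 'X^(q * j).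
Let cond a u k := \sum_(j < lam.+1) (D k l (r_ u j) + a *: D k (l + N) (t_ u j)) * 'X^j.

Let size_cond a u k : (k < l)%N -> (size (cond a u k) <= d + m * l + lam)%N.
Proof.
move=> ltkl; apply: leq_trans (size_sum _ _ _) _; apply/bigmax_leqP => j _.
apply: leq_trans (size_polyMleq _ _) _; rewrite size_polyXn addnS /=.
apply: leq_add; last by rewrite -ltnS.
apply: (@leq_trans (d + m * k)); last by rewrite leq_add2l leq_mul2l ltnW ?orbT.
apply: leq_trans (size_polyD _ _) _; rewrite geq_max.
rewrite size_D ?size_poly ?(ltnW ltkl) //=.
apply: leq_trans (size_scale_leq _ _) _.
by rewrite size_D ?size_poly // ltnW // ltn_addr.
Qed.

Let cond_sub a u v k : cond a (u - v) k = cond a u k - cond a v k.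
Proof.
rewrite /cond -sumrB; apply: eq_bigr => j _.
rewrite /r_ /t_ !linearB /= !D_is_additive scalerBr; ring.
Qed.

(** Pigeonhole: 2(lam + 1)d unknowns against l(d + ml + lam) equations. Two inputs share an image,
    and [cond] is additive, so their difference is a solution. *)
Let cond_solution a : exists2 u : coefs, u != 0 & forall k, (k < l)%N -> cond a u k = 0.
Proof.
pose out u : 'M[F]_(l, d + m * l + lam) := \matrix_k poly_rV (cond a u k).
have : ~ injective out.
  move/leq_card; rewrite card_mx card_prod !card_mx -expnD.
  rewrite leq_exp2l ?finNzRing_gt1 // leqNgt => /negP; apply.
  by rewrite /l; nia.
move=> ninj.
have [[u v] /andP [/= neq_uv /eqP out_uv]|no_uv] :=
    pickP (fun uv : coefs * coefs => (uv.1 != uv.2) && (out uv.1 == out uv.2)).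
  exists (u - v); first by rewrite subr_eq0.
  move=> k ltkl; rewrite cond_sub; apply/eqP; rewrite subr_eq0; apply/eqP.
  have := congr1 (row (Ordinal ltkl)) out_uv; rewrite !rowK.
  by move/(congr1 rVpoly); rewrite !poly_rV_K ?size_cond.
case: ninj => u v out_uv; apply/eqP; have := no_uv (u, v).
by rewrite /= out_uv eqxx andbT => /negbFE.
Qed.

(** Once f^l is cancelled, [stepanov_independent] is used twice: it provides the hypothesis of
    [sum_mulXn_eq0], then splits each vanishing coefficient into its two parts. *)
Let aux_neq0 u : u != 0 -> aux u != 0.
Proof.
apply: contraNneq => aux0.
have eq0 : forall j, (j < lam.+1)%N -> r_ u j + t_ u j * f ^+ N = 0.
  apply: (@sum_mulXn_eq0 _ q) => [j _ /stepanov_independent|].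
    by rewrite !size_poly => -[] // -> ->; rewrite mul0r addr0.
  apply: (mulfI (expf_neq0 l f_neq0)); rewrite mulr0 -[RHS]aux0 mulr_sumr.
  by apply: eq_bigr => j _; rewrite exprD; ring.
have rt0 j : r_ u j = 0 /\ t_ u j = 0.
  apply: stepanov_independent; rewrite ?size_poly //.
  have := eq0 (@inord lam j) (ltn_ord _); rewrite /r_ /t_ inord_val => ->.
  exact: dvdp0.
case: u {aux0 eq0} rt0 => u v rt0; apply/eqP; congr (_, _); apply/row_matrixP => j.
  by rewrite row0 -[LHS]rVpolyK; have [] := rt0 j; rewrite /r_ inord_val /= => -> _; rewrite linear0.
by rewrite row0 -[LHS]rVpolyK; have [] := rt0 j; rewrite /t_ inord_val /= => _ ->; rewrite linear0.
Qed.

Let size_aux u : (size (aux u) <= d + m * (l + N) + q * lam)%N.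
Proof.
apply: leq_trans (size_sum _ _ _) _; apply/bigmax_leqP => j _.
apply: leq_trans (size_polyMleq _ _) _; rewrite size_polyXn addnS /=.
apply: leq_add; last by rewrite leq_mul2l -ltnS ltn_ord orbT.
apply: leq_trans (size_polyD _ _) _; rewrite geq_max; apply/andP; split.
  apply: leq_trans (size_polyMleq _ _) _; rewrite size_fX addnS /=.
  by apply: leq_add; rewrite ?size_poly // leq_mul2l leq_addr orbT.
by apply: leq_trans (size_polyMleq _ _) _; rewrite size_fX addnS leq_add2r size_poly.
Qed.

Let dvdp_aux a u x : (forall k, (k < l)%N -> cond a u k = 0) ->
  f.[x] ^+ N = a -> ('X - x%:P) ^+ l %| aux u.
Proof.
move=> cond0 fx.
have lelq : (l <= q)%N by rewrite /l; nia.
pose A j := r_ u j * f ^+ l + t_ u j * f ^+ (l + N).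
(* X^(qj) agrees with the constant x^j modulo (X - x)^l, since [l <= q]; Hasse derivatives then act
   on [A j] alone. *)
suff dvA : ('X - x%:P) ^+ l %| \sum_(j < lam.+1) x ^+ j *: A j.
  rewrite -[aux u](subrK (\sum_(j < lam.+1) x ^+ j *: A j)) dvdp_addr // -sumrB.
  apply: (big_ind (fun p => _ %| p)) => [|p p'|j _]; rewrite ?dvdp0 //.
    exact: dvdp_add.
  by rewrite -mul_polyC mulrC -mulrBl mulrC -/(A j) dvdp_mull // dvdp_XsubC_expX.
apply: dvdp_XsubC_expP => k ltkl.
have := congr1 (fun p => f.[x] ^+ (l - k) * p.[x]) (cond0 k ltkl).
rewrite horner0 mulr0 => <-.
rewrite linear_sum /= !horner_sum mulr_sumr; apply: eq_bigr => j _.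
rewrite nderivnZ nderivnD !D_eq -addnBAC ?(ltnW ltkl) // exprD !(hornerZ, hornerD, hornerM, horner_exp, hornerX) fx.
ring.
Qed.

(** The nonzero polynomial [aux u] has a zero of order 2 lam at each counted point, so its degree
    bounds their number. *)
Lemma stepanov_bound (a : F) :
  (2 * lam * #|[set x | f.[x] ^+ N == a]| <= d + m * (2 * lam + N) + q * lam)%N.
Proof.
have [u u0 cond0] := cond_solution a.
set S := [set x | _].
have dvS : (\prod_(x <- enum S) ('X - x%:P)) ^+ l %| aux u.
  apply: dvdp_prod_XsubC_exp; first exact: enum_uniq.
  by move=> x; rewrite mem_enum inE => /eqP; apply: dvdp_aux.
have := leq_trans (dvdp_leq (aux_neq0 u0) dvS) (size_aux u).
rewrite size_monic_exp ?monic_prod_XsubC // size_prod_XsubC /= -cardE mulnC.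
exact: ltnW.
Qed.

End Stepanov.

(** * The quadratic character *)

(** Euler's criterion: for odd [q] the exponent is (q - 1)/2. Values lie in [int] so that character
    sums can be compared in size. *)
Definition quadchar (F : finFieldType) (x : F) : int :=
  if x == 0 then 0 else if x ^+ #|F|./2 == 1 then 1 else -1.

Section QuadraticCharacter.

Variable F : finFieldType.
Hypothesis q_odd : odd #|F|.
Local Notation q := #|F|.
Local Notation chi := (@quadchar F).

Lemma card_odd_half : q = q./2.*2.+1.
Proof. by rewrite -[LHS]odd_double_half q_odd. Qed.

Lemma card_half_gt0 : (0 < q./2)%N.
Proof. by have := finNzRing_gt1 F; rewrite card_odd_half; case: _./2. Qed.

Lemma odd_card_two_neq0 : 2%:R != 0 :> F.
Proof.
apply/negP => F2; have pF : 2%N \in [pchar F] by rewrite inE.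
have := q_odd; rewrite (card_pprimeChar pF) oddX orbF => /eqP n0.
by have := finNzRing_gt1 F; rewrite (card_pprimeChar pF) n0.
Qed.

Lemma expf_card_pred (x : F) : x != 0 -> x ^+ q./2.*2 = 1.
Proof.
move=> x0; apply: (mulfI x0); rewrite mulr1 -exprS -card_odd_half.
exact: expf_card.
Qed.

Lemma expf_half_card (x : F) : x != 0 -> (x ^+ q./2 == 1) || (x ^+ q./2 == -1).
Proof. by move=> x0; rewrite -sqrf_eq1 -exprM muln2 expf_card_pred. Qed.

Lemma quadchar0 : chi 0 = 0. Proof. by rewrite /quadchar eqxx. Qed.

Lemma quadcharE (x : F) (e : bool) :
  x != 0 -> (chi x == (-1) ^+ e) = (x ^+ q./2 == (-1) ^+ e).
Proof.
move=> x0; rewrite /quadchar (negPf x0).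
have F11 : (-1 == 1 :> F) = false.
  apply/negbTE; rewrite eq_sym -subr_eq0 opprK -(mulr2n 1); exact: odd_card_two_neq0.
have /orP [/eqP->|/eqP->] := expf_half_card x0; case: e; rewrite ?expr0 ?expr1 ?eqxx ?(eq_sym (1 : F)) ?F11 // ?eqxx.
Qed.

Lemma quadchar_sign (x : F) : x != 0 -> exists e : bool, chi x = (-1) ^+ e.
Proof.
by move=> x0; rewrite /quadchar (negPf x0); case: ifP; [exists false | exists true].
Qed.

Lemma quadcharM (x y : F) : chi (x * y) = chi x * chi y.
Proof.
have [->|x0] := eqVneq x 0; first by rewrite mul0r quadchar0 mul0r.
have [->|y0] := eqVneq y 0; first by rewrite mulr0 quadchar0 mulr0.
have [[e ex] [e' ey]] := (quadchar_sign x0, quadchar_sign y0).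
rewrite ex ey -signr_addb; apply/eqP; rewrite quadcharE ?mulf_neq0 //.
move/eqP: ex; move/eqP: ey; rewrite !quadcharE // exprMn => /eqP-> /eqP->.
by rewrite signr_addb.
Qed.

Lemma quadchar_sqr (x : F) : x != 0 -> chi (x ^+ 2) = 1.
Proof. by move=> x0; rewrite quadcharM; have [[] ->] := quadchar_sign x0. Qed.

Lemma quadchar_sqr_neq (x z : F) : chi x = -1 -> x != z ^+ 2.
Proof.
move=> chix; apply/eqP => xz; move: chix; rewrite xz.
by have [->|z0] := eqVneq z 0; rewrite ?expr0n ?quadchar0 ?quadchar_sqr.
Qed.

Lemma primitive_root_exists : exists g : F, q./2.*2.-primitive_root g.
Proof.
have /hasP [g _ gP] : has q./2.*2.-primitive_root (enum (predC1 (0 : F))); last by exists g.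
apply: has_prim_root; rewrite ?enum_uniq //.
- by rewrite double_gt0 card_half_gt0.
- by apply/allP => x; rewrite mem_enum inE => /expf_card_pred x1; apply/unity_rootP.
by rewrite -cardE cardC1 [X in (_ <= X.-1)%N]card_odd_half.
Qed.

(** If x = g^i with [g] primitive, then x^((q-1)/2) = 1 forces [i] to be even. *)
Lemma quadchar1_sqr (x : F) : chi x = 1 -> exists z, x = z ^+ 2.
Proof.
have [->|x0] := eqVneq x 0; first by rewrite quadchar0.
move/eqP; rewrite (quadcharE false x0) expr0 => xN.
have [g gP] := primitive_root_exists.
have [[i _] /= xi] := prim_rootP gP (expf_card_pred x0).
move: xN; rewrite xi -exprM -(prim_order_dvd gP) -muln2 mulnC dvdn_pmul2r ?card_half_gt0 //.
by move=> /dvdnP [j ->]; exists (g ^+ j); rewrite exprM.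
Qed.

Lemma nonsquare_exists : exists g : F, chi g = -1.
Proof.
have [g gP] := primitive_root_exists.
have N0 := card_half_gt0.
have g0 : g != 0 by rewrite (prim_root_eq0 gP) -lt0n double_gt0.
exists g; have [[] // /eqP] := quadchar_sign g0.
rewrite quadcharE // expr0 -(prim_order_dvd gP) => /dvdn_leq; lia.
Qed.

Lemma sum_quadchar : \sum_(x : F) chi x = 0.
Proof.
have [g chig] := nonsquare_exists.
have g0 : g != 0 by apply: contra_eq_neq chig => ->; rewrite quadchar0.
have : \sum_(x : F) chi x = - \sum_(x : F) chi x; last by lia.
rewrite [LHS](reindex_inj (mulfI g0)) -sumrN; apply: eq_bigr => x _.
by rewrite quadcharM chig mulN1r.
Qed.

(** Substituting d/x for x turns the summand into the character of (d/x)^2 (1 + x), and the square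
    drops out; the full sum of [chi] is 0, and the excluded x = 0 costs [chi 1]. *)
Lemma sum_quadchar_shift (d : F) : d != 0 -> \sum_x chi x * chi (x + d) = -1.
Proof.
move=> d0; rewrite (bigD1 0) //= quadchar0 mul0r add0r.
transitivity (\sum_(x : F | x != 0) chi (1 + x)).
  rewrite (reindex_onto (fun x => d / x) (fun x => d / x)) /=; last first.
    by move=> x x0; rewrite invf_div mulrCA divff ?mulr1.
  apply: eq_big => [x|x /andP [dx0 _]].
    have [->|x0] := eqVneq x 0; first by rewrite invr0 mulr0 eqxx.
    by rewrite mulf_neq0 ?invr_eq0 //= invf_div mulrCA divff // mulr1 eqxx.
  have x0 : x != 0 by apply: contra dx0 => /eqP ->; rewrite invr0 mulr0.
  rewrite -quadcharM (_ : _ * _ = (d / x) ^+ 2 * (1 + x)).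
    by rewrite quadcharM quadchar_sqr // mul1r.
  by field.
have := sum_quadchar; rewrite (reindex_inj (addrI 1)) (bigD1 0) //= addr0.
have -> : chi 1 = 1 by rewrite -(expr1n F 2) quadchar_sqr ?oner_neq0.
by rewrite addrC => /eqP; rewrite addr_eq0 => /eqP.
Qed.

Lemma sum_quadchar_pair (c a b : F) : c != 0 ->
  \sum_x chi (c * x + a) * chi (c * x + b) <= (if a == b then q%:Z else 0).
Proof.
move=> c0; case: ifP => [_|/negbT ab].
  have -> : q%:Z = \sum_(x : F) 1 by rewrite sumr_const cardT -cardE /= natz.
  apply: ler_sum => x _; rewrite -quadcharM.
  by rewrite /quadchar; case: ifP => //; case: ifP.
have := @sum_quadchar_shift (b - a); rewrite subr_eq0 eq_sym => /(_ ab) sum1.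
have inj : injective (fun x => c^-1 * (x - a)).
  by move=> x y /(mulfI _) e; apply: (addIr (- a)); apply: e; rewrite invr_eq0.
rewrite (reindex_inj inj) /=.
under eq_bigr => x _ do rewrite !mulVKf // subrK -addrA (addrC (- a)).
by rewrite sum1.
Qed.

Lemma nonsquare_values_card (A : {set F}) (c d : F) : c != 0 -> d != 0 ->
  (forall u w z, u \in A -> w \in A -> c * w + d * u ^+ 2 != z ^+ 2) ->
  (#|A| ^ 2 <= 2 * q)%N.
Proof.
move=> c0 d0 nsq.
have chiA u w : u \in A -> w \in A -> chi (c * w + d * u ^+ 2) = -1.
  move=> uA wA; have n0 : c * w + d * u ^+ 2 != 0.
    by have := nsq u w 0 uA wA; rewrite expr0n.
  have [[] //] := quadchar_sign n0.
  by rewrite expr0 => /quadchar1_sqr [z zE]; have := nsq u w z uA wA; rewrite zE eqxx.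
pose G w := \sum_(u in A) chi (c * w + d * u ^+ 2).
(* Every [w] in [A] has [G w] equal to -|A|. *)
have lower : (#|A| ^ 3)%N%:Z <= \sum_w G w ^+ 2.
  rewrite (bigID (mem A)) /= -[leLHS]addr0; apply: lerD; last first.
    by apply: sumr_ge0 => w _; apply: sqr_ge0.
  rewrite (eq_bigr (fun=> (#|A| ^ 2)%N%:Z)); last first.
    move=> w wA; rewrite /G (eq_bigr (fun=> -1)) => [|u uA]; last exact: chiA.
    by rewrite sumr_const mulNrn sqrrN natz -rmorphXn.
  by rewrite sumr_const -mulr_natr natz -PoszM -expnSr.
have upper : \sum_w G w ^+ 2 <= (#|A| * (2 * q))%N%:Z.
  have -> : \sum_w G w ^+ 2 = \sum_(u in A) \sum_(u' in A) \sum_w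
      chi (c * w + d * u ^+ 2) * chi (c * w + d * u' ^+ 2).
    transitivity (\sum_w \sum_(u in A) \sum_(u' in A)
        chi (c * w + d * u ^+ 2) * chi (c * w + d * u' ^+ 2)).
      apply: eq_bigr => w _; rewrite expr2 mulr_suml; apply: eq_bigr => u _.
      by rewrite mulr_sumr.
    by rewrite exchange_big; apply: eq_bigr => u _; rewrite exchange_big.
  have -> : (#|A| * (2 * q))%N%:Z = \sum_(u in A) (2 * q)%N%:Z.
    by rewrite sumr_const -mulr_natl natz PoszM.
  apply: ler_sum => u uA.
  (* Only u' = u and u' = -u give equal shifts; all other pairs contribute a nonpositive amount. *)
  apply: (@le_trans _ _ (\sum_(u' in A) if u' \in [set u; - u] then q%:Z else 0)).
    apply: ler_sum => u' _; apply: le_trans (sum_quadchar_pair _ _ c0) _.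
    rewrite (inj_eq (mulfI d0)) eqf_sqr !inE eq_sym.
    by rewrite -(eqr_opp u) opprK (eq_sym (- u)).
  rewrite -big_mkcondr /= sumr_const -mulr_natl natz -PoszM lez_nat leq_mul2r.
  apply/orP; right; apply: (@leq_trans #|[set u; - u]|); last by rewrite cards2 ltnS leq_b1.
  by apply/subset_leq_card/subsetP => x; rewrite unfold_in /= => /andP [].
have := le_trans lower upper; rewrite lez_nat expnS.
have [->|A0] := posnP #|A|; first by rewrite exp0n.
by rewrite leq_pmul2l.
Qed.

End QuadraticCharacter.

(** * Character sums over products, and sets with only nonsquare values *)

Lemma prodr_addr1_subset (R : comNzRingType) (T : finType) (A : {set T}) (E : T -> R) :
  \prod_(y in A) (E y + 1) = \sum_(J : {set T} | J \subset A) \prod_(y in J) E y.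
Proof.
rewrite big_mkcond /=.
rewrite (eq_bigr (fun y => (if y \in A then E y else 0) + 1)); last first.
  by move=> y _; case: ifP; rewrite ?add0r.
rewrite bigA_distr [RHS]big_mkcond /=; apply: eq_bigr => J _.
rewrite -big_mkcond /=; case: ifP => [/subsetP JA|/negbT /subsetPn [y yJ yA]].
  by apply: eq_bigr => y /JA ->.
by rewrite (bigD1 y) //= (negPf yA) mul0r.
Qed.

Section CharacterSums.

Variable F : finFieldType.
Hypothesis q_odd : odd #|F|.
Local Notation q := #|F|.
Local Notation chi := (@quadchar F).

Lemma card_nonroots (J : {set F}) :
  #|[set x | \prod_(y in J) (x - y) != 0]| = (q - #|J|)%N.
Proof.
rewrite -(cardsC J) addKn; apply: eq_card => x; rewrite !inE.
by apply/prodf_neq0/idP => [xJ|xJ y yJ]; [apply/negP => /xJ; rewrite subrr eqxx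
  | rewrite subr_eq0; apply: contraNneq xJ => ->].
Qed.

(** Stepanov's bound holds for both signs, and the two fibres together have q - |J| points; upper
    bounds on both therefore control their difference. *)
Lemma sum_quadchar_prod_bound (J : {set F}) (lam : nat) :
  J != set0 -> 0 \notin J -> (0 < lam)%N ->
  (4 * lam ^ 2 * #|J| + 2 * lam ^ 2 + #|J| + 1 < q)%N ->
  (2 * lam)%N%:Z * `|\sum_x \prod_(y in J) chi (x - y)|
    <= (#|J|.+1 * q + 6 * #|J| * lam)%N%:Z.
Proof.
move=> J0 J00 lam0 small.
have qE := card_odd_half q_odd.
pose f x := \prod_(y in J) (x - y).
have fE x : (\prod_(y <- enum J) ('X - y%:P)).[x] = f x.
  by rewrite horner_prod /f -[in RHS]big_enum; apply: eq_bigr => y _; rewrite hornerXsubC.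
pose S (e : bool) := [set x | (f x != 0) && (chi (f x) == (-1) ^+ e)].
(* The largest value allowed by the condition 2d + |J| <= q. *)
pose d := ((q - #|J|)./2)%N.
have stS e : (2 * lam * #|S e| <= d + #|J| * (2 * lam + q./2) + q * lam)%N.
  have := @stepanov_bound F (enum J) (enum_uniq _) _ _ q./2 d lam qE _ lam0 _ ((-1) ^+ e).
  rewrite mem_enum -!cardE => /(_ J00) st; apply: leq_trans (st _ _ _).
  - rewrite leq_mul2l; apply/orP; right; apply/subset_leq_card/subsetP => x.
    by rewrite !inE fE => /andP [fx]; rewrite quadcharE.
  - by rewrite -size_eq0 -cardE cards_eq0.
  - by rewrite /d; lia.
  - by rewrite /d; nia.
have sumS : (#|S false| + #|S true| = q - #|J|)%N.
  rewrite -card_nonroots -cardsUI; have -> : S false :&: S true = set0.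
    apply/setP => x; rewrite !inE; case: (chi _ =P (-1) ^+ false) => [->|]; last by rewrite andbF.
    by rewrite !andbF.
  rewrite cards0 addn0; apply: eq_card => x; rewrite !inE -andb_orr -/(f x).
  have [//|fx] := eqVneq (f x) 0.
  by have [[] ->] := quadchar_sign fx.
have sumE : \sum_x \prod_(y in J) chi (x - y) = #|S false|%:Z - #|S true|%:Z.
  transitivity (\sum_x ((x \in S false)%:Z - (x \in S true)%:Z)).
    apply: eq_bigr => x _; transitivity (chi (f x)).
      by rewrite /f (big_morph _ (quadcharM q_odd) (_ : chi 1 = 1)) //
        -(expr1n F 2) quadchar_sqr ?oner_neq0.
    rewrite !inE; have [->|fx] := eqVneq (f x) 0; first by rewrite quadchar0.
    by have [[] ->] := quadchar_sign fx.
  rewrite sumrB; congr (_ - _); rewrite -sum1_card (big_morph Posz PoszD (erefl _)) [RHS]big_mkcond;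
    by apply: eq_bigr => x _; case: (x \in _).
rewrite sumE.
have := stS false; have := stS true.
have leJ : (#|J| <= q)%N := max_card _.
have dq : (2 * d + #|J| <= q)%N by rewrite /d; lia.
have Jq : (#|J| * q = 2 * (#|J| * q./2) + #|J|)%N by nia.
have lam_s12 : (lam * #|S false| + lam * #|S true| + lam * #|J| = lam * q)%N.
  by rewrite -!mulnDr sumS subnK.
by case: ger0P => _; lia.
Qed.

Lemma quadchar_translate_const (A : {set F}) (e : bool) :
  A != set0 -> 0 \notin A -> (2 ^ (8 * #|A|) <= q)%N ->
  exists2 t : F, t != 0 & {in A, forall y, chi (t - y) = (-1) ^+ e}.
Proof.
move=> A0 A00 q_large.
have [t /andP [t0 /forall_inP tP]|no_t] :=
    pickP (fun t : F => (t != 0) && [forall y in A, chi (t - y) == (-1) ^+ e]).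
  by exists t => // y /tP /eqP.
exfalso; set M := #|A|%N in q_large.
have M0 : (0 < M)%N by rewrite card_gt0.
pose P := (2 ^ M)%N; have MP : (M < P)%N by apply: ltn_expl.
have P2 : (2 <= P)%N by apply: leq_trans MP.
have PqE : (P ^ 8 <= q)%N by rewrite -expnM mulnC.
(* Summed over [P] subsets, the part (M + 1)q/(2 lam) of the error is then exactly q/2, half of the
   main term. *)
pose lam := (P * M.+1)%N.
(* Up to the factor 2^M, this is the indicator of the wanted [t] away from [A]. With no such [t],
   only 0 and the points of [A] can contribute to its sum. *)
pose W t := \prod_(y in A) ((-1) ^+ e * chi (t - y) + 1).
have Wle t : W t <= if t \in 0 |: A then P%:Z else 0.
  have fac_le y : 0 <= (-1) ^+ e * chi (t - y) + 1 <= (2 : int).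
    have [->|/(quadchar_sign) [e' ->]] := eqVneq (t - y) 0; first by rewrite quadchar0 mulr0.
    by rewrite -signr_addb; case: (_ (+) _).
  have Wbd : W t <= P%:Z.
    rewrite /W /P -natz natrX -prodr_const; apply: ler_prod => y _; exact: fac_le.
  case: ifP => // /negbT; rewrite !inE negb_or => /andP [t0 tA].
  have /negbT := no_t t; rewrite t0 /= => /forall_inPn [y yA nchi].
  rewrite /W (bigD1 y) //=.
  have : t - y != 0 by rewrite subr_eq0; apply: contraNneq tA => ->.
  move/(quadchar_sign) => [e' chie]; move: nchi; rewrite chie -signr_addb.
  have [<-|ne _] := eqVneq e e'; first by rewrite eqxx.
  by rewrite (_ : e (+) e' = true) ?expr1 ?addNr ?mul0r //; case: (e) (e') ne => [] [].
have sumW_le : \sum_t W t <= (M.+1 * P)%N%:Z.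
  apply: le_trans (ler_sum _ (fun t _ => Wle t)) _.
  rewrite -big_mkcond sumr_const -mulr_natl natz -PoszM lez_nat leq_mul2r.
  by rewrite cardsU1 A00 add1n leqnn orbT.
pose K := (M.+1 * q + 6 * M * lam)%N.
have lam0 : (0 < lam)%N by rewrite muln_gt0 expn_gt0.
(* As [lam] is at most P^2, the left side is below 8 P^5, and 8 <= P^3; this accounts for the 8 in
   [2 ^ (8 * #|A|)]. *)
have small : (4 * lam ^ 2 * M + 2 * lam ^ 2 + M + 1 < q)%N.
  have lamP : (lam <= P ^ 2)%N by rewrite /lam expnS expn1 leq_mul2l MP orbT.
  have lamP4 : (lam ^ 2 <= P ^ 4)%N by rewrite (expnM P 2 2) leq_exp2r.
  have P5 : (P ^ 8 = P ^ 4 * P * P ^ 3)%N by rewrite -expnSr -expnD.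
  have P1 : (P <= P ^ 4 * P)%N by rewrite leq_pmull // expn_gt0 ltnW.
  apply: leq_trans PqE; rewrite P5; apply: (@leq_trans (P ^ 4 * P * 8)%N); last first.
    by rewrite leq_mul2l (@leq_exp2r 2 P 3) // P2 orbT.
  have : ((4 * M + 2) * lam ^ 2 <= (4 * P) * P ^ 4)%N by apply: leq_mul => //; lia.
  by move: (lam ^ 2)%N (P ^ 4)%N P1 => x y; nia.
have sumW_ge : (2 * lam)%N%:Z * \sum_t W t >= (2 * lam * q)%N%:Z - (P * K)%N%:Z.
  have -> : \sum_t W t = \sum_(J : {set F} | J \subset A)
      (\sum_t \prod_(y in J) ((-1) ^+ e * chi (t - y))).
    by rewrite exchange_big; apply: eq_bigr => t _; rewrite /W prodr_addr1_subset.
  rewrite (bigD1 set0) ?sub0set //= mulrDr.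
  rewrite (eq_bigr (fun=> 1)) => [|t _]; last by rewrite big_set0.
  rewrite sumr_const -[1 *+ _]/(_%:R) natz -PoszM lerD2l mulr_sumr.
  (* Charging [K] to the empty set as well makes the number of terms exactly [P]. *)
  have -> : - (P * K)%N%:Z = \sum_(J in powerset A) - K%:Z.
    by rewrite sumr_const card_powerset -/P mulNrn -mulr_natl natz PoszM.
  rewrite (bigD1 set0) ?powersetE ?sub0set //= -[leRHS]add0r; apply: lerD; first by rewrite oppr_le0.
  under eq_bigl => J do rewrite powersetE.
  apply: ler_sum => J /andP [JA J0].
  have J00 : 0 \notin J by apply: contra A00; apply: (subsetP JA).
  have JM : (#|J| <= M)%N := subset_leq_card JA.
  under eq_bigr do rewrite big_split prodr_const /=.
  rewrite -mulr_sumr.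
  apply: lerNnormlW; rewrite !normrM normrX normr_sign expr1n mul1r.
  apply: le_trans (sum_quadchar_prod_bound J0 J00 lam0 _) _.
    by apply: leq_ltn_trans small; rewrite !leq_add ?leq_mul.
  by rewrite lez_nat /K; apply: leq_add; rewrite !leq_mul.
have := le_trans sumW_ge (ler_wpM2l (le0z_nat _) sumW_le).
have PKE : (P * K = lam * q + lam * (6 * M * P))%N by rewrite /K /lam; ring.
rewrite PKE -PoszM lerBlDr -PoszD lez_nat => le_q.
have : (lam * q <= lam * (6 * M * P + 2 * (M.+1 * P)))%N by lia.
rewrite leq_pmul2l // leqNgt => /negP; apply; apply: leq_trans PqE.
have P5 : (P ^ 8 = P * P * P ^ 6)%N by rewrite -mulnA -!expnS.
apply: (@leq_trans (P * P * 64)%N); last first.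
  by rewrite P5 leq_mul2l (@leq_exp2r 2 P 6) // P2 orbT.
have MPP : (M.+1 * P <= P * P)%N by rewrite leq_mul2r MP orbT.
have PP0 : (0 < P * P)%N by rewrite muln_gt0 expn_gt0.
by move: (P) MPP PP0 => p; clear; lia.
Qed.

Lemma nonsquare_values_exists (c d : F) (k : nat) :
  c != 0 -> d != 0 -> (2 ^ (24 * k) <= q)%N ->
  exists2 A : {set F}, #|A| = k &
    forall u w z, u \in A -> w \in A -> c * w + d * u ^+ 2 != z ^+ 2.
Proof.
move=> c0 d0 q_large.
have [->|k0] := posnP k.
  by exists set0 => [|u w z]; rewrite ?cards0 // inE.
have [g gP] := primitive_root_exists q_odd.
have g0 : g != 0 by rewrite (prim_root_eq0 gP) -lt0n double_gt0 card_half_gt0.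
(* This makes the powers g^(2i) with i < k distinct, so that the set has [k] elements. *)
have ltkN : (k < q./2)%N.
  have : (k < 2 ^ k)%N by apply: ltn_expl.
  have : (2 ^ k * 2 ^ 2 <= 2 ^ (24 * k))%N by rewrite -expnD leq_exp2l //; lia.
  have := card_odd_half q_odd; move: q_large; lia.
(* The sign turns t - y into t + h^l with h = g^2. At most 3k elements at cost 8 each explain the
   exponent 24k. *)
pose B := [set - (g ^+ 2) ^+ l | l : 'I_(3 * k)].
have leB : (#|B| <= 3 * k)%N by apply: leq_trans (leq_imset_card _ _) _; rewrite card_ord.
have [e chid] := quadchar_sign d0.
have [t t0 tP] : exists2 t : F, t != 0 & {in B, forall y, chi (t - y) = (-1) ^+ ~~ e}.
  apply: quadchar_translate_const.
  - have k3 : (0 < 3 * k)%N by rewrite muln_gt0.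
    by apply/set0Pn; exists (- (g ^+ 2) ^+ Ordinal k3); apply: imset_f.
  - by apply/imsetP => -[l _ /eqP]; rewrite eq_sym oppr_eq0 !expf_eq0 (negPf g0) !andbF.
  by apply: leq_trans q_large; rewrite leq_exp2l // -(mulnA 8 3) leq_mul2l.
(* Chosen to give [cE], which allows d times a square to be factored out of c w + d u^2; afterwards
   only [cE] is remembered about [s]. *)
pose s := c * g ^+ (2 * k) / (d * t).
have s0 : s != 0 by rewrite !mulf_neq0 ?invr_eq0 ?mulf_neq0 ?expf_neq0.
have cE : c = d * s * t / g ^+ (2 * k).
  by rewrite /s; field; rewrite d0 t0 expf_neq0.
move: (s) s0 cE => {}s s0 cE.
exists [set s * g ^+ (2 * i) | i : 'I_k].
  rewrite card_imset ?card_ord // => i j /(mulfI s0) /eqP.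
  rewrite (eq_prim_root_expr gP) -mul2n -!muln_modr eqn_pmul2l //.
  by rewrite !modn_small ?(ltn_trans (ltn_ord _) ltkN) // => /eqP /val_inj.
move=> u w z /imsetP [i _ ->] /imsetP [j _ ->]; apply: quadchar_sqr_neq => //.
(* The added [k], matched by g^(2k) in [s], keeps the exponent from being truncated since j < k. *)
have ltl : (2 * i + k - j < 3 * k)%N by have := ltn_ord i; have := ltn_ord j; lia.
pose v := t + (g ^+ 2) ^+ (2 * i + k - j).
have -> : c * (s * g ^+ (2 * j)) + d * (s * g ^+ (2 * i)) ^+ 2
        = d * (s * g ^+ j / g ^+ k) ^+ 2 * v.
  have -> : v = t + g ^+ (4 * i) * g ^+ (2 * k) / g ^+ (2 * j).
    rewrite /v -exprM -exprD -expfB_cond //; first by congr (_ + g ^+ _); lia.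
    by rewrite (negPf g0); have := ltn_ord j; lia.
  rewrite {1}cE !(mulnC _ k) !(mulnC _ (nat_of_ord j)) !(mulnC _ (nat_of_ord i)) !exprM.
  by field; rewrite !expf_neq0.
have sq0 : s * g ^+ j / g ^+ k != 0 by rewrite !mulf_eq0 invr_eq0 !expf_eq0 (negPf s0) (negPf g0) !andbF.
rewrite (quadcharM q_odd _ v) (quadcharM q_odd d) quadchar_sqr // mulr1.
have -> : v = t - (- (g ^+ 2) ^+ Ordinal ltl) by rewrite opprK.
rewrite chid tP; last exact: imset_f.
by rewrite -signr_addb addbN addbb.
Qed.

End CharacterSums.

(** * Reduction to squares *)

Section Forms.

Variables (F : finFieldType) (a1 a2 b1 b2 b3 : F).
Local Notation L := (linear_form a1 a2).
Local Notation Q := (quadratic_form b1 b2 b3).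

(* The value Q(a2, -a1) of Q at the zero of L. *)
Let gam := b1 * a2 ^+ 2 - b2 * a1 * a2 + b3 * a1 ^+ 2.

Lemma eval2_linear_form x y : eval2 L x y = a1 * x + a2 * y.
Proof. by rewrite /eval2 /linear_form mevalD !mevalZ !mevalXU !(tnth_nth 0). Qed.

Lemma eval2_quadratic_form x y :
  eval2 Q x y = b1 * x ^+ 2 + b2 * (x * y) + b3 * y ^+ 2.
Proof.
by rewrite /eval2 /quadratic_form !mevalD !mevalZ !mevalM !mevalXU !(tnth_nth 0).
Qed.

Lemma linear_form_neq0 : L != 0 -> (a1 != 0) || (a2 != 0).
Proof.
apply: contraNT; rewrite negb_or !negbK => /andP [/eqP -> /eqP ->].
by rewrite /linear_form !scale0r addr0.
Qed.

Lemma quadratic_form_at_zero_neq0 :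
  L != 0 -> ~ (exists M : {mpoly F[2]}, Q = M * L) -> gam != 0.
Proof.
move=> /linear_form_neq0 L0 ndiv; apply/eqP => gam0; apply: ndiv.
pose P (u v : F) : {mpoly F[2]} := u *: 'X_0 + v *: 'X_1.
have PL u v : P u v * L
  = (u * a1) *: 'X_0 ^+ 2 + (u * a2 + v * a1) *: ('X_0 * 'X_1) + (v * a2) *: 'X_1 ^+ 2.
  rewrite /P /linear_form -!mul_mpolyC !mpolyCD !mpolyCM; ring.
have [a10|a10] := eqVneq a1 0.
  have a20 : a2 != 0 by move: L0; rewrite a10 eqxx.
  exists (P (b2 / a2) (b3 / a2)); rewrite PL a10 !mulr0 addr0 !divfK //.
  suff -> : b1 = 0 by [].
  apply/eqP; move/eqP: gam0; rewrite /gam a10 mulr0 mul0r subr0 expr0n mulr0 addr0.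
  by rewrite mulf_eq0 expf_eq0 (negPf a20) orbF.
(* Quotient of Q by L as polynomials in X; the remainder is gam/a1^2 times Y^2. *)
exists (P (b1 / a1) ((b2 * a1 - a2 * b1) / a1 ^+ 2)); rewrite PL divfK //.
congr (_ + _ *: _ + _ *: _); first by field.
apply: (mulIf (expf_neq0 2 a10)); apply/eqP; rewrite -subr_eq0; apply/eqP.
by rewrite -[RHS]gam0 /gam; field.
Qed.

Lemma represented_iff (A : {set F}) : 2%:R != 0 :> F -> gam != 0 ->
  (exists x y, (eval2 L x y \in A) && (eval2 Q x y \in A)) <->
  (exists u w z, [/\ u \in A, w \in A
    & 4%:R * gam * w + disc b1 b2 b3 * u ^+ 2 = z ^+ 2]).
Proof.
move=> F2 gam0.
pose M x y := (b2 * a1 - 2%:R * b1 * a2) * x + (2%:R * b3 * a1 - b2 * a2) * y.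
have sqM x y :
  4%:R * gam * eval2 Q x y + disc b1 b2 b3 * eval2 L x y ^+ 2 = M x y ^+ 2.
  by rewrite eval2_linear_form eval2_quadratic_form /gam /disc /M; ring.
have g2 : 2%:R * gam != 0 by rewrite mulf_neq0.
have F4gam : 4%:R * gam != 0 by rewrite (natrM _ 2 2) -mulrA mulf_neq0.
split=> [[x [y /andP [Lx Qx]]]|[u [w [z [uA wA uwz]]]]].
  by exists (eval2 L x y), (eval2 Q x y), (M x y).
(* Cramer's rule for L = u, M = z, a system of determinant [2%:R * gam]. *)
pose x := ((2%:R * b3 * a1 - b2 * a2) * u - a2 * z) / (2%:R * gam).
pose y := (a1 * z - (b2 * a1 - 2%:R * b1 * a2) * u) / (2%:R * gam).
have Lx : eval2 L x y = u.
  rewrite eval2_linear_form /x /y !mulrA -mulrDl.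
  by apply: (canLR (mulfK g2)); rewrite /gam; ring.
have Mx : M x y = z.
  rewrite /M /x /y !mulrA -mulrDl.
  by apply: (canLR (mulfK g2)); rewrite /gam; ring.
exists x, y; rewrite Lx uA /=; suff -> : eval2 Q x y = w by [].
have := sqM x y; rewrite Lx Mx -uwz => /addIr /mulfI; apply.
exact: F4gam.
Qed.

Lemma Nq_bounds : odd #|F| -> disc b1 b2 b3 != 0 -> gam != 0 ->
  (#|F| < 2 ^ (24 * Nq L Q))%N /\ (Nq L Q ^ 2 <= 9 * #|F|)%N.
Proof.
move=> q_odd disc0 gam0.
have F2 := odd_card_two_neq0 q_odd.
have c0 : 4%:R * gam != 0 by rewrite (natrM _ 2 2) !mulf_neq0.
rewrite /Nq; case: ex_minnP => n nP n_min; split.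
  rewrite ltnNge; apply/negP => /(nonsquare_values_exists q_odd c0 disc0) [A cardA nsq].
  move/forallP: nP => /(_ A); rewrite cardA leqnn /= => /existsP [x /existsP [y xyA]].
  have /(represented_iff A F2 gam0) [u [w [z [uA wA /eqP]]]] :
    exists x y, (eval2 L x y \in A) && (eval2 Q x y \in A) by exists x, y.
  by rewrite (negPf (nsq u w z uA wA)).
(* Minimality gives a bad set at the threshold one below; the factor 9 in place of 2 absorbs this
   shift. *)
case: n nP n_min => // n _ n_min.
have : ~~ represented_in_large_sets L Q n by apply/negP => /n_min; rewrite ltnn.
move=> /forallPn [A]; rewrite negb_imply => /andP [leA nrep].
have : (#|A| ^ 2 <= 2 * #|F|)%N.
  apply: (nonsquare_values_card q_odd c0 disc0) => u w z uA wA; apply: contra nrep => /eqP uwz.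
  have /(represented_iff A F2 gam0) [x [y xyA]] : exists u w z, [/\ u \in A, w \in A
    & 4%:R * gam * w + disc b1 b2 b3 * u ^+ 2 = z ^+ 2] by exists u, w, z.
  by apply/existsP; exists x; apply/existsP; exists y.
have : (0 < #|F|)%N by apply/card_gt0P; exists 0.
have : (n ^ 2 <= #|A| ^ 2)%N by rewrite leq_exp2r.
by move: (#|A|) (#|F|) => a q; nia.
Qed.

End Forms.

Theorem theorem1 (R : realType) :
  exists c1 c2 : R, [/\ 0 < c1, 0 < c2 &
    forall (F : finFieldType) (a1 a2 b1 b2 b3 : F),
      let q : nat := #|F| in
      let L : {mpoly F[2]} := linear_form a1 a2 in
      let Q : {mpoly F[2]} := quadratic_form b1 b2 b3 in
      odd q ->
      disc b1 b2 b3 != 0 ->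
      L != 0 ->
      ~ (exists M : {mpoly F[2]}, Q = M * L) ->
      c1 * exp.ln (q%:R : R) <= (Nq L Q)%:R <= c2 * Num.sqrt (q%:R : R)].
Proof.
have ln2 : 0 < exp.ln (2%:R : R) by rewrite exp.ln_gt0 // ltr1n.
(* The constants come from taking the logarithm of q < 2^(24 Nq) and the square root of Nq^2 <=
   9q. *)
exists (24%:R * exp.ln 2%:R)^-1, 3%:R; split; rewrite ?ltr0n ?invr_gt0 ?mulr_gt0 ?ltr0n //.
move=> F a1 a2 b1 b2 b3 q L Q q_odd disc0 L0 ndiv.
have [lower upper] := Nq_bounds q_odd disc0 (quadratic_form_at_zero_neq0 L0 ndiv).
apply/andP; split.
  rewrite ler_pdivrMl ?mulr_gt0 ?ltr0n // mulrAC -natrM mulr_natl -exp.lnXn ?ltr0n //.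
  rewrite exp.ler_ln ?posrE ?exprn_gt0 ?ltr0n //; last by apply/card_gt0P; exists 0.
  by rewrite -natrX ler_nat ltnW.
rewrite -(ler_pXn2r (ltn0Sn 1)) ?nnegrE ?mulr_ge0 ?sqrtr_ge0 //.
by rewrite exprMn sqr_sqrtr // -!natrX -natrM ler_nat.
Qed.
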